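(* Let $\omega\in\mathbb{C}^n$ and $t\in\mathbb{C}^m_B$. Then $f=\Phi(\omega;t)$ is a cusp of $\check X_A$ if and only if $P_A(t)=0$.
   Context: Setting. Let $n\ge1$ and let $A=(\alpha_1,\dots,\alpha_N)$ be a real $(1+n)\times N$ matrix (a point configuration; columns need not be distinct) of rank $1+n$ whose top row is the all ones vector. Let $m=N-n-1\ge1$. Let $\hat A$ be the $n\times N$ matrix obtained by deleting the top row of $A$, with columns $\hat\alpha_1,\dots,\hat\alpha_N$. A Gale dual of $A$ is an $N\times m$ matrix $B$ of rank $m$ with $AB=0$; fix one, with rows $\beta_1,\dots,\beta_N$, and write $\langle\beta,t\rangle=\sum_i\beta_it_i$ for $t\in\mathbb{C}^m$. Put $\mathbb{C}^m_B=\{t\in\mathbb{C}^m:\langle\beta_k,t\rangle\ne0\text{ for all }k\}$. Cuspidal form. With $\Sigma$ the set of $n$-element subsets $\sigma\subset\{1,\dots,N\}$ and $|\hat A_\sigma|$ the determinant of the $n\times n$ submatrix of $\hat A$ with columns in $\sigma$, $$P_A(t)=\sum_{\sigma\in\Sigma}|\hat A_\sigma|^2\prod_{k\in\sigma}\langle\beta_k,t\rangle .$$ Discriminant variety and cusps. $(\mathbb{C}^\times)^A$ denotes the family of exponential sums $f=\sum_k c_k e^{\langle w,\alpha_k\rangle}$, $c_k\in\mathbb{C}^\times$, identified with $(c_1,\dots,c_N)$, and $\check X_A$ is the set of those $f$ having a singular point. It is parametrized by the (dehomogenized, $\omega_0=1$) Horn–Kapranov map $\Phi:\mathbb{C}^n\times\mathbb{C}^m_B\to\check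 X_A\subset(\mathbb{C}^\times)^A$, $\Phi(\omega;t)=\big(e^{1+\langle\omega,\hat\alpha_k\rangle}\langle\beta_k,t\rangle\big)_{k=1}^N$. The point $f=\Phi(\omega;t)$ is called a cusp of $\check X_A$ if the image of the differential $d\Phi$ at $(\omega;t)$ has dimension at most $N-2=n+m-1$, i.e. if the $(n+m)\times N$ Jacobian matrix of $\Phi$ at $(\omega;t)$ has rank at most $n+m-1$. *)

(* Defs.v *)
From HB Require Import structures.
From mathcomp Require Import all_boot all_order all_algebra.
From mathcomp Require Import complex.
From mathcomp Require Import all_classical all_reals all_analysis.

Set Implicit Arguments.
Unset Strict Implicit.
Unset Printing Implicit Defensive.

Import Order.TTheory GRing.Theory Num.Theory.
Import numFieldNormedType.Exports.

Local Open Scope ring_scope.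
Local Open Scope complex_scope.

Definition cexp (R : realType) (z : R[i]) : R[i] :=
  (expR (complex.Re z))%:C * (cos (complex.Im z) +i* sin (complex.Im z)).

Definition point_configuration (R : realType) (n N : nat)
    (A : 'M[R]_(1 + n, N)) : Prop :=
  \rank A = (1 + n)%N /\ usubmx A = const_mx 1.

Definition Ahat (R : realType) (n N : nat) (A : 'M[R]_(1 + n, N)) :
    'M[R]_(n, N) :=
  dsubmx A.

(* The Gale dual is allowed to have complex entries; a real Gale dual is the
   special case of a matrix of the form [map_mx (real_complex R) B]. *)
Definition gale_dual (R : realType) (n m N : nat)
    (A : 'M[R]_(1 + n, N)) (B : 'M[R[i]]_(N, m)) : Prop :=
  \rank B = m /\ map_mx (real_complex R) A *m B = 0.

(* The bilinear pairing <beta_k, t>, without conjugation. *)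
Definition pairing (R : realType) (m N : nat)
    (B : 'M[R[i]]_(N, m)) (k : 'I_N) (t : 'rV[R[i]]_m) : R[i] :=
  \sum_(i < m) B k i * t 0 i.

Definition in_CmB (R : realType) (m N : nat)
    (B : 'M[R[i]]_(N, m)) (t : 'rV[R[i]]_m) : Prop :=
  forall k : 'I_N, pairing B k t != 0.

Definition nsubset (n N : nat) : Type :=
  {s : {set 'I_N} | #|s| == n}.

(* The j-th element of s, in increasing order. *)
Definition nsubset_elt (n N : nat) (s : nsubset n N) (j : 'I_n) : 'I_N :=
  enum_val (cast_ord (esym (eqP (valP s))) j).

Definition cuspidal_form (R : realType) (n m N : nat)
    (A : 'M[R]_(1 + n, N)) (B : 'M[R[i]]_(N, m)) (t : 'rV[R[i]]_m) : R[i] :=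
  \sum_(s : nsubset n N)
     ((\det (colsub (nsubset_elt s) (Ahat A))) ^+ 2)%:C *
     \prod_(k in val s) pairing B k t.

(* The Horn-Kapranov map at z = (w; t), with C^n x C^m identified with
   C^(n+m) by concatenation. The formula makes sense for every t; since
   C^m_B is open, this does not affect the differential at points of C^m_B. *)
Definition horn_kapranov (R : realType) (n m N : nat)
    (A : 'M[R]_(1 + n, N)) (B : 'M[R[i]]_(N, m)) (z : 'rV[R[i]]_(n + m)) :
    'rV[R[i]]_N :=
  let w := lsubmx z in let t := rsubmx z in
  \row_(k < N)
    (cexp (1 + \sum_(j < n) w 0 j * (Ahat A j k)%:C) * pairing B k t).

(* Being a cusp is a property of the parameter (w; t), i.e. of a branch of the
   discriminant variety, rather than of its image point alone. The rows of
   the Jacobian matrix ['J f p] are indexed by the source coordinates. *)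
Definition is_cusp (R : realType) (n m N : nat)
    (A : 'M[R]_(1 + n, N)) (B : 'M[R[i]]_(N, m))
    (w : 'rV[R[i]]_n) (t : 'rV[R[i]]_m) : Prop :=
  (\rank ('J (horn_kapranov A B) (row_mx w t)) <= n + m - 1)%N.

(* Main.v *)
Require Import Defs.
From HB Require Import structures.
From mathcomp Require Import all_boot all_order all_fingroup all_algebra.
From mathcomp Require Import complex.
From mathcomp Require Import all_classical all_reals all_analysis.
From mathcomp Require Import zify ring lra.

Set Implicit Arguments.
Unset Strict Implicit.
Unset Printing Implicit Defensive.

Import Order.TTheory GRing.Theory Num.Theory.
Import numFieldNormedType.Exports.

Local Open Scope ring_scope.
Local Open Scope complex_scope.

(** The Jacobian of [Phi] at [(w; t)] is, up to the invertible diagonal matrix of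
    exponentials, the matrix with row blocks [Ahat * D] and [B^T], where [D] is
    the diagonal matrix of the [<beta_k, t>]. The rows of [B^T] span the kernel
    of [A], so this matrix has rank [m + rank (Ahat * D * A^T)]. The column of
    [Ahat * D * A^T] coming from the all-ones row of [A] is [Ahat * B * t = 0],
    so [Phi] has a cusp exactly when [Ahat * D * Ahat^T] is singular, and its
    determinant is [P_A(t)] by the Cauchy-Binet formula. *)

(** * The Cauchy-Binet formula *)

Section CauchyBinet.
Variables (F : comNzRingType) (n N : nat).
Implicit Types (X : 'M[F]_(n, N)) (Y : 'M[F]_(N, n)) (s : nsubset n N).

Lemma nsubset_elt_inj s : injective (nsubset_elt s).
Proof. by move=> i j /enum_val_inj /cast_ord_inj. Qed.

Lemma mem_nsubset_elt s j : nsubset_elt s j \in val s.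
Proof. exact: enum_valP. Qed.

Lemma imset_nsubset_elt s : nsubset_elt s @: [set: 'I_n] = val s.
Proof.
apply/eqP; rewrite eqEcard card_imset ?cardsT ?card_ord; last exact: nsubset_elt_inj.
rewrite (eqP (valP s)) leqnn andbT.
by apply/fintype.subsetP => _ /imsetP[j _ ->]; exact: mem_nsubset_elt.
Qed.

Lemma prod_nsubset_elt s (p : 'I_N -> F) :
  \prod_(j < n) p (nsubset_elt s j) = \prod_(k in val s) p k.
Proof.
rewrite -{1}(imset_nsubset_elt s) big_imset /=; last first.
  by move=> i j _ _; exact: nsubset_elt_inj.
by apply: eq_bigl => i; rewrite inE.
Qed.

(** Distribute the Leibniz product over the sums defining the entries of [X *m Y]: [f] records the
    summation index chosen in each row. *)
Lemma det_mulmx_ffun X Y : \det (X *m Y) =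
  \sum_(f : {ffun 'I_n -> 'I_N}) (\prod_i X i (f i)) * \det (rowsub f Y).
Proof.
rewrite /determinant.
under eq_bigr => sg _.
  under eq_bigr => i _ do rewrite mxE.
  rewrite bigA_distr_bigA big_distrr /=.
  over.
rewrite exchange_big; apply: eq_bigr => f _ /=.
rewrite big_distrr /=; apply: eq_bigr => sg _.
rewrite mulrCA; congr (_ * _); rewrite -big_split /=.
by apply: eq_bigr => i _; rewrite mxE.
Qed.

(** An injection with image [s] is the increasing enumeration of [s] after a unique permutation;
    this turns a sum over such maps into a sum over ['S_n]. *)
Lemma imset_perm_nsubset_elt s (f : {ffun 'I_n -> 'I_N}) :
  (f \in [set [ffun i => nsubset_elt s (sg i)] | sg : 'S_n]) =
  injectiveb f && (f @: [set: 'I_n] == val s).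
Proof.
apply/imsetP/andP => [[sg _ ->]|[/injectiveP f_inj /eqP fs]].
  split.
    by apply/injectiveP => i j; rewrite !ffunE => /nsubset_elt_inj /perm_inj.
  rewrite -(imset_nsubset_elt s); apply/eqP/setP => k.
  apply/imsetP/imsetP => -[i _ ->].
    by exists (sg i); rewrite ?ffunE.
  by exists (sg^-1%g i); rewrite ?ffunE ?permKV.
have ex i : exists j, nsubset_elt s j == f i.
  have : f i \in val s by rewrite -fs imset_f.
  by rewrite -imset_nsubset_elt => /imsetP[j _ ->]; exists j.
pose g i := xchoose (ex i).
have gE i : nsubset_elt s (g i) = f i by apply/eqP; exact: xchooseP (ex i).
have g_inj : injective g by move=> i j /(congr1 (nsubset_elt s)); rewrite !gE => /f_inj.
by exists (perm g_inj) => //; apply/ffunP => i; rewrite ffunE permE gE.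
Qed.

(** Non-injective [f] repeat a row of [Y] and contribute nothing; the others are grouped by
    image. *)
Lemma cauchy_binet X Y : \det (X *m Y) =
  \sum_(s : nsubset n N)
    \det (colsub (nsubset_elt s) X) * \det (rowsub (nsubset_elt s) Y).
Proof.
rewrite det_mulmx_ffun (bigID (fun f : {ffun 'I_n -> 'I_N} => injectiveb f)) /=.
rewrite [X in _ + X]big1 ?addr0 => [|f /injectivePn[i [j neq_ij fij]]]; last first.
  rewrite (determinant_alternate neq_ij) ?mulr0 // => k.
  by rewrite !mxE fij.
rewrite (partition_big (fun f : {ffun 'I_n -> 'I_N} => f @: [set: 'I_n])
  (fun s : {set 'I_N} => #|s| == n)) /=; last first.
  by move=> f /injectiveP f_inj; rewrite card_imset ?cardsT ?card_ord.
rewrite big_sub /=; apply: eq_bigr => s _.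
under eq_bigl => f do rewrite -imset_perm_nsubset_elt.
rewrite big_imset /=; last first.
  move=> sg tau _ _ /ffunP e; apply/permP => i.
  by have := e i; rewrite !ffunE => /nsubset_elt_inj.
(* Sorting the rows of [Y] releases the sign of [sg], which is the sign missing from the Leibniz
   expansion of the minor of [X]. *)
rewrite {2}/determinant big_distrl /=; apply: eq_big => [sg|sg _].
  by rewrite inE.
have -> : rowsub [ffun i => nsubset_elt s (sg i)] Y =
    row_perm sg (rowsub (nsubset_elt s) Y).
  by apply/matrixP => i j; rewrite !mxE ffunE.
rewrite row_permE det_mulmx det_perm mulrCA mulrA; congr (_ * _ * _).
by apply: eq_bigr => i _; rewrite mxE ffunE.
Qed.

(** The diagonal factor scales columns, so both minors attached to [s] are the same minor of [X], up
    to the product of the scalars in [s]. *)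
Lemma det_mul_diag_tr X (p : 'rV[F]_N) : \det (X *m diag_mx p *m X^T) =
  \sum_(s : nsubset n N)
    \det (colsub (nsubset_elt s) X) ^+ 2 * \prod_(k in val s) p 0 k.
Proof.
rewrite cauchy_binet; apply: eq_bigr => s _.
have -> : colsub (nsubset_elt s) (X *m diag_mx p) =
    colsub (nsubset_elt s) X *m diag_mx (colsub (nsubset_elt s) p).
  by apply/matrixP => i j; rewrite !mul_mx_diag !mxE.
have -> : rowsub (nsubset_elt s) X^T = (colsub (nsubset_elt s) X)^T.
  by apply/matrixP => i j; rewrite !mxE.
rewrite det_mulmx det_tr det_diag expr2 mulrAC -prod_nsubset_elt.
by congr (_ * _); apply: eq_bigr => j _; rewrite mxE.
Qed.

End CauchyBinet.

(** * Rank of a matrix stacked on generators of a kernel *)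

Section RankFormula.
Variables (F : fieldType) (n m r N : nat).

(* The rows of [G] span the kernel of [K], so a vector of the row space of [C]
   lies in the row space of [G] exactly when [K] kills it. *)
Lemma mxrank_col_mx_ker (C : 'M[F]_(n, N)) (G : 'M[F]_(m, N))
    (K : 'M[F]_(r, N)) :
  K *m G^T = 0 -> (\rank K + \rank G)%N = N ->
  \rank (col_mx C G) = (\rank (C *m K^T) + \rank G)%N.
Proof.
move=> KG0 rKG.
have eqG : (G :=: kermx K^T)%MS.
  apply/eqmxP; rewrite -mxrank_leqif_eq ?mxrank_ker ?mxrank_tr
    -?[X in (X - _)%N]rKG ?addKn //.
  by apply/sub_kermxP; rewrite -[LHS]trmxK trmx_mul trmxK KG0 trmx0.
(* The rank lost from [C] to [C *m K^T] is that of the intersection with [G], which therefore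
   cancels. *)
have := mxrank_sum_cap C G.
rewrite -(mxrank_mul_ker C K^T) -(cap_eqmx (eqmx_refl C) eqG).
by rewrite addsmxE addnAC => /eqP; rewrite eqn_add2r => /eqP.
Qed.

End RankFormula.

Lemma mxrank_col_mx_gale (F : fieldType) (n m N : nat)
    (A : 'M[F]_(1 + n, N)) (B : 'M[F]_(N, m)) (t : 'rV[F]_m) :
  usubmx A = const_mx 1 -> \rank A = (1 + n)%N -> \rank B = m ->
  A *m B = 0 -> N = (1 + n + m)%N ->
  \rank (col_mx (dsubmx A *m diag_mx (t *m B^T)) B^T) =
  (\rank (dsubmx A *m diag_mx (t *m B^T) *m (dsubmx A)^T) + m)%N.
Proof.
move=> A1 rA rB AB0 NE.
rewrite (@mxrank_col_mx_ker _ _ _ _ _ _ _ A) ?trmxK ?mxrank_tr ?rA ?rB //.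
congr (_ + _)%N.
rewrite -[X in _ *m X^T]vsubmxK tr_col_mx mul_mx_row A1.
(* The diagonal matrix sends the all-ones column to the column of pairings, which [A] kills. *)
have eqBt : diag_mx (t *m B^T) *m (const_mx 1)^T = B *m t^T :> 'cV_N.
  rewrite -[RHS]trmxK trmx_mul trmxK.
  by apply/matrixP => i j; rewrite mul_diag_mx !mxE mulr1 ord1.
rewrite -[X in row_mx X]mulmxA eqBt mulmxA.
have := AB0; rewrite -[A in A *m _]vsubmxK mul_col_mx.
move=> /(congr1 dsubmx); rewrite col_mxKd linear0 => ->.
by rewrite mul0mx rank_row_0mx.
Qed.

(** * The derivative of the complex exponential *)

(** Multiplicativity makes the difference quotient at [z] equal to [E z] times the one at 0, so a
    first-order estimate at 0 suffices. *)
Lemma is_derive_exponential (K : numFieldType) (E : K -> K) :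
  (forall x y, E (x + y) = E x * E y) -> (forall x, E x != 0) ->
  (forall e : K, 0 < e -> exists2 d : K, 0 < d &
    forall h, `|h| < d -> `|E h - 1 - h| <= e * `|h|) ->
  forall z, is_derive z (1 : K) E (E z).
Proof.
move=> ED E0 E1 z.
suff H : ((fun h : K => h^-1 *: ((E \o shift z) (h *: 1) - E z))
    @ (0 : K)^' --> E z)%classic.
  by apply: DeriveDef; [apply/cvg_ex; exists (E z)|exact: cvg_lim].
have cz0 : 0 < `|E z| by rewrite normr_gt0.
apply/cvgrPdist_le => e e0.
have [d d0 Hd] := E1 _ (divr_gt0 e0 cz0).
apply/nbhs_ballP; exists d => // h /=; rewrite /ball /= sub0r normrN => hd h0.
have -> : E z - h^-1 *: (E (h *: 1 + z) - E z) =
    - (E z * (h^-1 * (E h - 1 - h))).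
  by rewrite /GRing.scale /= mulr1 ED; field.
rewrite normrN !normrM normfV mulrCA ler_pdivrMl ?normr_gt0 //.
apply: le_trans (ler_wpM2l (ltW cz0) (Hd h hd)) _.
by rewrite mulrA mulrCA divff ?mulr1 ?lt0r_neq0 // mulrC.
Qed.

Section ComplexExponential.
Variable R : realType.
Local Notation C := (R[i] : numFieldType).
Implicit Types z h : C.

Lemma cexpD z h : cexp (z + h) = cexp z * cexp h.
Proof.
case: z h => [a b] [c d]; rewrite /cexp /= expRD cosD sinD.
by apply/eqP; rewrite eq_complex /=; apply/andP; split; apply/eqP; ring.
Qed.

Lemma cexp0 : cexp (0 : R[i]) = 1.
Proof. by rewrite /cexp /= expR0 cos0 sin0 mul1r. Qed.

Lemma cexp_neq0 z : cexp z != 0.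
Proof.
apply/eqP => z0; have := cexpD z (- z).
by rewrite subrr cexp0 z0 mul0r => /eqP; rewrite oner_eq0.
Qed.

Lemma derive1_approx (f : R -> R) (df e : R) : is_derive (0 : R) (1 : R) f df -> 0 < e ->
  exists2 d : R, 0 < d & forall x, `|x| < d -> `|f x - f 0 - x * df| <= e * `|x|.
Proof.
move=> fdf e0; have := @derivable_nbhs R R R f 0 1 (ex_derive (is_derive:=fdf)).
rewrite derive_val => /eqaddoP /(_ e e0) /nbhs_ballP [d /= d0 H].
exists d => // x xd; have := H x.
rewrite /ball /= sub0r normrN => /(_ xd); rewrite /= !fctE /= addr0.
by rewrite /GRing.scale /= mulr1 opprD addrA.
Qed.

Lemma normc_le_ReIm (a b : R) : `|a +i* b| <= (`|a| + `|b|)%:C.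
Proof.
rewrite normc_def /= lecR -[leRHS]ger0_norm ?addr_ge0 //.
rewrite -sqrtr_sqr ler_wsqrtr // sqrrD !real_normK ?num_real //.
by rewrite addrAC lerDl mulrn_wge0 // mulr_ge0.
Qed.

Lemma cexp_approx (e : R[i]) : 0 < e -> exists2 d : R[i], 0 < d &
  forall h, `|h| < d -> `|cexp h - 1 - h| <= e * `|h|.
Proof.
case: e => e e'; rewrite ltcE /= => /andP[/eqP -> e0].
(* The two bounds below add up to [3r|a| + 4r|b|], at most [7r] times the modulus, so [8] leaves
   room. *)
have [r r0 ->] : exists2 r : R, 0 < r & e = 8 * r.
  by exists (e / 8); [rewrite divr_gt0|field].
have [d1 d10 H1] := derive1_approx (is_derive_expR 0) r0.
have [d2 d20 H2] := derive1_approx (is_derive_cos 0) r0.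
have [d3 d30 H3] := derive1_approx (is_derive_sin 0) r0.
(* The bound [1] gives [|1 + a| <= 2]; the bound [r] absorbs the second-order term [a * b] of the
   imaginary part. *)
pose d := Num.min (Num.min d1 d2) (Num.min d3 (Num.min 1 r)).
exists d%:C => [|[a b] hd].
  by rewrite ltcR !lt_min d10 d20 d30 ltr01 r0.
have ad : `|a| < d by rewrite -ltcR; exact: le_lt_trans (normc_ge_Re (a +i* b)) hd.
have bd : `|b| < d.
  rewrite -ltcR; apply: le_lt_trans hd; rewrite normc_def /= lecR.
  by rewrite -sqrtr_sqr ler_wsqrtr // lerDr sqr_ge0.
move: ad bd; rewrite !lt_min => /and4P[/andP[a1 a2] a3 a4 a5].
move=> /and4P[/andP[b1 b2] b3 b4 b5].
have := H1 a a1; have := H2 b b2; have := H3 b b3.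
rewrite expR0 sin0 cos0 !oppr0 mulr0 oppr0 !addr0 !mulr1 => sb cb ea.
have leRe : `|a| <= Num.sqrt (a ^+ 2 + b ^+ 2).
  by rewrite -sqrtr_sqr ler_wsqrtr // lerDl sqr_ge0.
have leIm : `|b| <= Num.sqrt (a ^+ 2 + b ^+ 2).
  by rewrite -sqrtr_sqr ler_wsqrtr // lerDr sqr_ge0.
have -> : cexp (a +i* b) - 1 - (a +i* b) =
   (expR a * cos b - 1 - a) +i* (expR a * sin b - b).
  by rewrite /cexp /=; apply/eqP; rewrite eq_complex /=; apply/andP; split;
    apply/eqP; ring.
apply: le_trans (normc_le_ReIm _ _) _.
rewrite normc_def -[8 * r +i* 0]/((8 * r)%:C) -rmorphM lecR /=.
have bRe : `|expR a * cos b - 1 - a| <= r * `|a| + 2 * r * `|b|.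
  have -> : expR a * cos b - 1 - a =
    (expR a - 1 - a) * cos b + (1 + a) * (cos b - 1) by ring.
  apply: le_trans (ler_normD _ _) _; rewrite !normrM.
  have cb1 : `|cos b| <= 1 by rewrite ler_norml cos_geN1 cos_le1.
  have a1' : `|1 + a| <= 2.
    by apply: le_trans (ler_normD _ _) _; rewrite normr1; lra.
  apply: lerD; last by rewrite -mulrA ler_pM.
  by rewrite -[leRHS]mulr1 ler_pM.
have bIm : `|expR a * sin b - b| <= 2 * r * `|a| + 2 * r * `|b|.
  have -> : expR a * sin b - b =
    (expR a - 1 - a) * sin b + (1 + a) * (sin b - b) + a * b by ring.
  apply: le_trans (ler_normD _ _) _.
  have sb1 : `|sin b| <= 1 by rewrite ler_norml sin_geN1 sin_le1.
  have a1' : `|1 + a| <= 2.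
    by apply: le_trans (ler_normD _ _) _; rewrite normr1; lra.
  have -> : 2 * r * `|a| + 2 * r * `|b| =
    r * `|a| * 1 + 2 * (r * `|b|) + `|a| * r by ring.
  apply: lerD; last by rewrite normrM ler_pM // ltW.
  apply: le_trans (ler_normD _ _) _; rewrite !normrM.
  by apply: lerD; rewrite ler_pM.
apply: le_trans (lerD bRe bIm) _.
have := ler_wpM2l (ltW r0) leRe; have := ler_wpM2l (ltW r0) leIm.
have := mulr_ge0 (ltW r0) (normr_ge0 a).
move: (Num.sqrt _) => *; lra.
Qed.

Lemma is_derive_cexp z : is_derive z (1 : C) (@cexp R : C -> C) (cexp z).
Proof.
exact: (is_derive_exponential (E := @cexp R : C -> C) cexpD cexp_neq0 cexp_approx).
Qed.

End ComplexExponential.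

(** * Differentials of row-valued maps and of linear forms *)

Section Diff.
Variables (K : numFieldType) (V : normedModType K) (N : nat).

Lemma differentiable_row (f : 'I_N -> V -> K) x :
  (forall k, differentiable (f k) x) ->
  differentiable (fun v => \row_k f k v : 'rV[K]_N) x.
Proof.
move=> df.
have -> : (fun v => \row_k f k v) =
    \sum_(k < N) (fun v => f k v *: (delta_mx 0 k : 'rV[K]_N)).
  apply/funext => v; rewrite fct_sumE [LHS]row_sum_delta.
  by apply: eq_bigr => k _; rewrite mxE.
apply: differentiable_sum => k; exact: differentiableZl.
Qed.

(** Chain rule with the coordinate projection, which is linear and continuous, hence its own
    differential. *)
Lemma diff_coord (f : V -> 'rV[K]_N) x v k : differentiable f x ->
  'd f x v 0 k = 'd (fun u => f u 0 k : K) x v.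
Proof.
move=> df.
have lc : linear (fun u : 'rV[K]_N => u 0 k : K).
  by move=> a u1 u2; rewrite !mxE.
pose c : {linear 'rV[K]_N -> K} :=
  HB.pack (fun u : 'rV[K]_N => u 0 k : K) (GRing.isLinear.Build _ _ _ _ _ lc).
have cc : continuous c by exact: coord_continuous.
have -> : (fun u => f u 0 k : K) = c \o f by [].
have dc : differentiable c (f x) by exact: linear_differentiable.
by rewrite (diff_comp df dc) (diff_lin _ cc).
Qed.

End Diff.

Lemma diff_mulmx_coord (K : numFieldType) (p q : nat) (C : 'M[K]_(p, q))
    (k : 'I_q) (x : 'rV[K]_p) :
  is_diff x (fun z : 'rV[K]_p => (z *m C) 0 k : K) (fun z => (z *m C) 0 k).
Proof.
(* Differentiability comes first, as a sum of scaled coordinates: it yields the continuity that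
   [diff_lin] asks for. *)
have df y : differentiable (fun z : 'rV[K]_p => (z *m C) 0 k : K) y.
  have -> : (fun z : 'rV[K]_p => (z *m C) 0 k : K) =
      \sum_(j < p) (fun z : 'rV[K]_p => C j k *: (z 0 j : K)).
    apply/funext => z; rewrite fct_sumE mxE; apply: eq_bigr => j _.
    by rewrite [RHS]mulrC.
  apply: differentiable_sum => j; apply: differentiableZ.
  exact: differentiable_coord.
have lf : linear (fun z : 'rV[K]_p => (z *m C) 0 k : K).
  by move=> a u v; rewrite mulmxDl -scalemxAl !mxE.
pose l : {linear 'rV[K]_p -> K} :=
  HB.pack (fun z : 'rV[K]_p => (z *m C) 0 k : K)
    (GRing.isLinear.Build _ _ _ _ _ lf).
apply: DiffDef; first exact: df.
apply: (@diff_lin _ _ _ l) => y.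
by apply: differentiable_continuous; exact: df.
Qed.

(** * The Jacobian matrix of the Horn-Kapranov map *)

Section HornKapranov.
Variables (R : realType) (n m N : nat).
Variables (A : 'M[R]_(1 + n, N)) (B : 'M[R[i]]_(N, m)).
Local Notation C := (R[i] : numFieldType).
Local Notation ah := (map_mx (real_complex R) (Ahat A)).

Lemma pairingE (t : 'rV[R[i]]_m) k : pairing B k t = (t *m B^T) 0 k.
Proof. by rewrite mxE; apply: eq_bigr => i _; rewrite mxE mulrC. Qed.

(** The zero blocks express the exponent and the pairing as linear forms in the whole of [z], ready
    for [diff_mulmx_coord]. *)
Lemma horn_kapranovE : horn_kapranov A B = fun z => \row_k
  (cexp (1 + (z *m col_mx ah 0) 0 k) * (z *m col_mx 0 B^T) 0 k).
Proof.
apply/funext => z; apply/rowP => k; rewrite [LHS]mxE [RHS]mxE pairingE.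
have -> : z *m col_mx ah 0 = lsubmx z *m ah.
  by rewrite -{1}[z]hsubmxK mul_row_col mulmx0 addr0.
have -> : z *m col_mx 0 B^T = rsubmx z *m B^T.
  by rewrite -{1}[z]hsubmxK mul_row_col mulmx0 add0r.
congr (cexp (1 + _) * _).
by rewrite [RHS]mxE; apply: eq_bigr => j _; rewrite !mxE.
Qed.

(** By the product rule, both terms of the differential of coordinate [k] carry the same
    exponential, which factors out as a scaling of column [k]. *)
Lemma jacobian_horn_kapranov (w : 'rV[C]_n) (t : 'rV[C]_m) :
  'J (horn_kapranov A B) (row_mx w t) =
  col_mx (ah *m diag_mx (t *m B^T)) B^T *m
    diag_mx (\row_k cexp (1 + (w *m ah) 0 k)).
Proof.
set x := row_mx w t.
pose f k (z : 'rV[C]_(n + m)) : C :=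
  cexp (1 + (z *m col_mx ah 0) 0 k) * (z *m col_mx 0 B^T) 0 k.
have fd k : is_diff x (f k) (fun v => cexp (1 + (w *m ah) 0 k) *
    ((v *m col_mx ah 0) 0 k * (t *m B^T) 0 k + (v *m col_mx 0 B^T) 0 k)).
  have d1 := diff_mulmx_coord (col_mx ah 0) k x.
  have d2 := diff_mulmx_coord (col_mx 0 B^T) k x.
  have d3 := is_diffD (is_diff_cst (1 : C) x) d1.
  have e3 : ((cst 1 : 'rV[C]_(n + m) -> C) +
      (fun z => (z *m col_mx ah 0) 0 k)) x = 1 + (w *m ah) 0 k.
    by rewrite fctE /= /x mul_row_col mulmx0 addr0.
  have de := is_derive_cexp (1 + (w *m ah) 0 k).
  have d4 : is_diff (1 + (w *m ah) 0 k) (@cexp R : C -> C)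
      ( *:%R^~ (cexp (1 + (w *m ah) 0 k))).
    apply: DiffDef; first exact/derivable1_diffP/ex_derive.
    by rewrite deriv1E ?derive1E ?derive_val //; exact: ex_derive.
  (* The chain rule needs the base point in the form of a value of the inner map. *)
  rewrite -e3 in d4.
  have := is_diffM (is_diff_comp d3 d4) d2.
  rewrite e3 => d5; apply: is_diff_eq.
  apply/funext => v; rewrite !fctE /= ?fctE /= /x !mul_row_col !mulmx0 addr0 !add0r.
  by rewrite /GRing.scale /=; ring.
have df : differentiable (horn_kapranov A B) x.
  by rewrite horn_kapranovE; apply: differentiable_row => k; case: (fd k).
apply/matrixP => i k; rewrite mxE diff_coord //.
have -> : (fun u => horn_kapranov A B u 0 k : C) = f k.
  by rewrite horn_kapranovE; apply/funext => u; rewrite mxE.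
rewrite (@diff_val _ _ _ _ _ _ _ (fd k)) -!rowE mul_mx_diag [RHS]mxE mulrC.
rewrite [row _ (col_mx ah 0) 0 k]mxE [row _ (col_mx 0 _) 0 k]mxE.
rewrite [X in _ = _ * X]mxE; congr (_ * _).
case: (split_ordP i) => j ->; rewrite ?col_mxEu ?col_mxEd.
  by rewrite mul_mx_diag !mxE addr0.
by rewrite !mxE mul0r add0r.
Qed.

End HornKapranov.

Theorem theorem3p4 (R : realType) (n m N : nat)
    (hn : (1 <= n)%N) (hmN : m = (N - n - 1)%N) (hm : (1 <= m)%N)
    (A : 'M[R]_(1 + n, N)) (hA : point_configuration A)
    (B : 'M[R[i]]_(N, m)) (hB : gale_dual A B)
    (w : 'rV[R[i]]_n) (t : 'rV[R[i]]_m) (ht : in_CmB B t) :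
  is_cusp A B w t <-> cuspidal_form A B t = 0.
Proof.
have [rA A1] := hA; have [rB AB0] := hB.
pose ah := map_mx (real_complex R) (Ahat A).
pose H := ah *m diag_mx (t *m B^T) *m ah^T.
have -> : cuspidal_form A B t = \det H.
  rewrite /H det_mul_diag_tr; apply: eq_bigr => s _; congr (_ * _).
    by rewrite -map_mxsub det_map_mx rmorphXn.
  by apply: eq_bigr => k _; rewrite pairingE.
rewrite /is_cusp jacobian_horn_kapranov mxrankMfree; last first.
  rewrite row_free_unit unitmxE det_diag unitfE.
  by apply/prodf_neq0 => k _; rewrite mxE cexp_neq0.
have rH : \rank (col_mx (ah *m diag_mx (t *m B^T)) B^T) = (\rank H + m)%N.
  have ahE : ah = dsubmx (map_mx (real_complex R) A) by rewrite -map_dsubmx.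
  (* Since [m] is positive, the subtraction [N - n - 1] is not truncated, whence [N = 1 + n + m]. *)
  rewrite /H ahE mxrank_col_mx_gale ?mxrank_map //; last by lia.
  by rewrite -map_usubmx A1; apply/matrixP => i j; rewrite !mxE.
rewrite -/ah rH.
(* Here too [n + m - 1] is a true subtraction, so the cusp condition says that the square matrix [H]
   is singular. *)
have -> : (\rank H + m <= n + m - 1)%N = (\rank H < n)%N by lia.
have /= := row_free_unit H; rewrite unitmxE unitfE /row_free => rfE.
rewrite ltn_neqAle rank_leq_row andbT rfE negbK.
by split=> /eqP.
Qed.
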